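(* Let $(d_n)_{n\ge1}$ be a fixed sequence of integers $d_n\ge2$. If the shift mapping $\hat\varphi$ has a derivative at a point $x=\Delta^{-D}_{\varepsilon_1\varepsilon_2\ldots\varepsilon_n\ldots}$ of $[a_0-1;a_0]$, then $$\left(\hat\varphi(x)\right)'=-d_1.$$
   Context: $A_{d_n}=\{0,1,\dots,d_n-1\}$, $a_0=\sum_{n=1}^{\infty}\frac{(-1)^{n+1}}{d_1\cdots d_n}$. For digits $\varepsilon_n\in A_{d_n}$ put $\Delta^{-D}_{\varepsilon_1\varepsilon_2\ldots}=\sum_{n=1}^{\infty}\frac{(-1)^n\varepsilon_n}{d_1d_2\cdots d_n}$; every number of $[a_0-1;a_0]$ has such a representation (some numbers have two; then one of the two is fixed and digits are read from it). The shift mapping $\hat\varphi$ on $[a_0-1;a_0]$ is $$\hat\varphi\left(\Delta^{-D}_{\varepsilon_1\varepsilon_2\varepsilon_3\ldots}\right)=\sum_{n=2}^{\infty}\frac{(-1)^{n-1}\varepsilon_n}{d_2d_3\cdots d_n}.$$ *)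

(* Defs.v *)
(* Stdlib reals with Coquelicot series. *)
From Stdlib Require Import Reals.
From Coquelicot Require Import Coquelicot.
Open Scope R_scope.

(* Sequences are indexed from 0: [d n] and [e n] stand for the usual
   d_{n+1} and epsilon_{n+1}, so that [prod_f_R0 (fun i => INR (d i)) n]
   is d_1 d_2 ... d_{n+1}. *)

Definition a0 (d : nat -> nat) : R :=
  Series (fun n => (-1) ^ n / prod_f_R0 (fun i => INR (d i)) n).

Definition segment (d : nat -> nat) (x : R) : Prop :=
  a0 d - 1 <= x <= a0 d.

(* For admissible digits and d n >= 2 the general term is bounded by
   1 / 2 ^ n, so the total operator [Series] is the genuine sum. *)
Definition Delta (d e : nat -> nat) : R :=
  Series (fun n => (-1) ^ (S n) * INR (e n) / prod_f_R0 (fun i => INR (d i)) n).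

Definition admissible (d e : nat -> nat) : Prop :=
  forall n, (e n < d n)%nat.

(* [eps x] is the representation from which the digits of [x] are read.
   For a number with two representations either of them may have been
   fixed. Nothing is required of [eps] outside the segment. *)
Definition digit_reading (d : nat -> nat) (eps : R -> nat -> nat) : Prop :=
  forall x, segment d x -> admissible d (eps x) /\ Delta d (eps x) = x.

(* sum_{n >= 2} (-1)^{n-1} epsilon_n / (d_2 ... d_n), reindexed by
   n = k + 2. *)
Definition shift_map (d : nat -> nat) (eps : R -> nat -> nat) (x : R) : R :=
  Series (fun k => (-1) ^ (S k) * INR (eps x (S k))
                   / prod_f_R0 (fun i => INR (d (S i))) k).

(* The limit of the difference quotient is taken along points of the segment,
   hence is one-sided at its two ends. *)
Definition shift_has_derivative (d : nat -> nat) (eps : R -> nat -> nat)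
    (x l : R) : Prop :=
  D_in (shift_map d eps) (fun _ => l) (segment d) x.

(* Main.v *)
Require Import Defs.
From Stdlib Require Import Reals Lra Lia.
From Coquelicot Require Import Coquelicot.
Open Scope R_scope.

(** Splitting the first term off the series of [x] gives
    [shift_map x = - d_1 x - epsilon_1(x)], where [epsilon_1(x)] is the first
    digit read from [x] ([shift_map_first_digit]). Hence the difference quotient
    of the shift between [x] and [y] is [- d_1 - k / (y - x)], with
    [k = epsilon_1(y) - epsilon_1(x)] an integer. If the quotient converges, it
    is bounded near [x], so [|k|] is at most a constant times [|y - x|], and
    [k = 0] once [y] is close enough to [x]; there the quotient equals [- d_1].
    The segment has length 1, so it does contain points [y <> x] arbitrarily
    close to [x]. Nothing has to be known about which of two representations of
    a number is the one its digits are read from. *)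

Lemma prod_f_R0_succ_l (f : nat -> R) (n : nat) :
  prod_f_R0 f (S n) = f 0%nat * prod_f_R0 (fun i => f (S i)) n.
Proof.
  induction n as [|n IH]; [reflexivity|].
  change (prod_f_R0 f (S (S n))) with (prod_f_R0 f (S n) * f (S (S n))).
  rewrite IH. simpl. ring.
Qed.

Lemma pow2_le_prod (d : nat -> nat) (hd : forall n, (2 <= d n)%nat) (n : nat) :
  2 ^ S n <= prod_f_R0 (fun i => INR (d i)) n.
Proof.
  assert (H2 : forall k, 2 <= INR (d k)) by (intro k; apply (le_INR 2), hd).
  induction n as [|n IH].
  - simpl. specialize (H2 0%nat). lra.
  - change (2 ^ S (S n)) with (2 * 2 ^ S n). simpl prod_f_R0.
    rewrite Rmult_comm.
    apply Rmult_le_compat; [apply pow_le; lra | lra | exact IH | apply H2].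
Qed.

Lemma prod_digits_pos (d : nat -> nat) (hd : forall n, (2 <= d n)%nat) (n : nat) :
  0 < prod_f_R0 (fun i => INR (d i)) n.
Proof.
  apply Rlt_le_trans with (2 := pow2_le_prod d hd n). apply pow_lt. lra.
Qed.

Lemma digit_pow2_le_prod (d e : nat -> nat) (hd : forall n, (2 <= d n)%nat)
    (he : admissible d e) (n : nat) :
  INR (e n) * 2 ^ n <= prod_f_R0 (fun i => INR (d i)) n.
Proof.
  assert (He : INR (e n) <= INR (d n)) by (apply le_INR, Nat.lt_le_incl, he).
  destruct n as [|n].
  - simpl. lra.
  - simpl prod_f_R0. rewrite Rmult_comm.
    apply Rmult_le_compat; [apply pow_le; lra | apply pos_INR | | exact He].
    apply pow2_le_prod, hd.
Qed.

Lemma ex_series_Delta (d e : nat -> nat) (hd : forall n, (2 <= d n)%nat)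
    (he : admissible d e) :
  ex_series (fun n => (-1) ^ S n * INR (e n) / prod_f_R0 (fun i => INR (d i)) n).
Proof.
  apply (ex_series_le (V := R_CompleteNormedModule)) with (fun n => (/ 2) ^ n).
  2: apply ex_series_geom; rewrite Rabs_pos_eq; lra.
  intro n.
  change (Rabs ((-1) ^ S n * INR (e n) / prod_f_R0 (fun i => INR (d i)) n)
          <= (/ 2) ^ n).
  assert (Hp := prod_digits_pos d hd n).
  assert (H2 : 0 < 2 ^ n) by (apply pow_lt; lra).
  rewrite Rabs_div by lra.
  rewrite Rabs_mult, pow_1_abs, Rmult_1_l.
  rewrite (Rabs_pos_eq (INR (e n))) by apply pos_INR.
  rewrite (Rabs_pos_eq (prod_f_R0 _ _)) by lra.
  rewrite pow_inv.
  apply Rle_div_l; [exact Hp|].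
  apply Rmult_le_reg_l with (2 ^ n); [exact H2|].
  rewrite <- Rmult_assoc, Rinv_r, Rmult_1_l by lra.
  rewrite Rmult_comm. apply digit_pow2_le_prod; assumption.
Qed.

(** The remaining digits, with [d] shifted, again represent a number, which
    enters the original expansion with the factor [- 1 / d_1].
    The qualified name is needed because [Delta] alone is the discriminant of a
    quadratic polynomial. *)
Lemma Delta_first_digit (d e : nat -> nat) (hd : forall n, (2 <= d n)%nat)
    (he : admissible d e) :
  INR (d 0%nat) * Defs.Delta d e
  = - INR (e 0%nat) - Defs.Delta (fun n => d (S n)) (fun n => e (S n)).
Proof.
  assert (H2 : 2 <= INR (d 0%nat)) by (apply (le_INR 2), hd).
  unfold Defs.Delta at 1.
  rewrite Series_incr_1 by (apply ex_series_Delta; assumption).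
  rewrite (Series_ext _ (fun k => - / INR (d 0%nat) *
     ((-1) ^ S k * INR (e (S k)) / prod_f_R0 (fun i => INR (d (S i))) k))).
  - rewrite Series_scal_l.
    fold (Defs.Delta (fun n => d (S n)) (fun n => e (S n))).
    simpl. field. lra.
  - intro k. rewrite prod_f_R0_succ_l.
    assert (Hp := prod_digits_pos (fun i => d (S i)) (fun i => hd (S i)) k).
    cbv beta in Hp.
    change ((-1) ^ S (S k)) with (-1 * (-1) ^ S k).
    field. lra.
Qed.

Lemma shift_map_first_digit (d : nat -> nat) (hd : forall n, (2 <= d n)%nat)
    (eps : R -> nat -> nat) (heps : digit_reading d eps)
    (x : R) (hx : segment d x) :
  shift_map d eps x = - INR (d 0%nat) * x - INR (eps x 0%nat).
Proof.
  destruct (heps x hx) as [he hD].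
  assert (H := Delta_first_digit d (eps x) hd he).
  rewrite hD in H.
  change (shift_map d eps x)
    with (Defs.Delta (fun n => d (S n)) (fun n => eps x (S n))).
  lra.
Qed.

Lemma INR_dist_ge_1 (m n : nat) : m <> n -> 1 <= Rabs (INR m - INR n).
Proof.
  intro H. destruct (Nat.lt_gt_cases m n) as [[h|h] _]; [exact H | |];
    apply le_INR in h; rewrite S_INR in h.
  - rewrite Rabs_left; lra.
  - rewrite Rabs_pos_eq; lra.
Qed.

Lemma segment_point_at_dist (d : nat -> nat) (x h : R) :
  segment d x -> 0 <= h <= 1 / 2 ->
  exists y, segment d y /\ Rabs (y - x) = h.
Proof.
  unfold segment. intros hx hh.
  destruct (Rle_dec x (a0 d - 1 / 2)) as [c|c].
  - exists (x + h). split; [lra|].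
    replace (x + h - x) with h by ring. apply Rabs_pos_eq; lra.
  - exists (x - h). split; [lra|].
    replace (x - h - x) with (- h) by ring. rewrite Rabs_Ropp.
    apply Rabs_pos_eq; lra.
Qed.

Theorem theorem4 (d : nat -> nat) (hd : forall n, (2 <= d n)%nat)
    (eps : R -> nat -> nat) (heps : digit_reading d eps)
    (x : R) (hx : segment d x)
    (l : R) (hl : shift_has_derivative d eps x l) :
  l = - INR (d 0%nat).
Proof.
  destruct (Req_dec l (- INR (d 0%nat))) as [|ne]; [assumption|exfalso].
  set (E := Rabs (l + INR (d 0%nat))).
  assert (HE : 0 < E) by (apply Rabs_pos_lt; lra).
  destruct (hl E HE) as [alp [Halp Hlim]].
  (* Within [1 / (2 E)] of [x], distinct first digits would put the quotient at
     distance at least [2 E] from [- d_1], which is at distance [E] from [l];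
     equal first digits make the quotient exactly [- d_1]. Neither leaves it
     at distance less than [E] from [l]. *)
  assert (HiE : 0 < / (2 * E)) by (apply Rinv_0_lt_compat; lra).
  set (h := Rmin (alp / 2) (Rmin (1 / 2) (/ (2 * E)))).
  assert (Hh : 0 < h) by (unfold h; repeat apply Rmin_glb_lt; lra).
  assert (Hh1 : h <= alp / 2) by apply Rmin_l.
  assert (Hh2 : h <= 1 / 2)
    by (eapply Rle_trans; [apply Rmin_r | apply Rmin_l]).
  assert (Hh3 : h <= / (2 * E))
    by (eapply Rle_trans; [apply Rmin_r | apply Rmin_r]).
  destruct (segment_point_at_dist d x h hx) as [y [hy Hyx]]; [lra|].
  assert (Hne : y - x <> 0)
    by (intro c; rewrite c, Rabs_R0 in Hyx; lra).
  assert (Hxy : x <> y) by (intro c; apply Hne; rewrite c; ring).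
  assert (Hd : Rabs (y - x) < alp) by lra.
  assert (Hq := Hlim y (conj (conj hy Hxy) Hd)).
  simpl in Hq. unfold Rdist in Hq.
  rewrite !(shift_map_first_digit d hd eps heps) in Hq by assumption.
  set (k := INR (eps y 0%nat) - INR (eps x 0%nat)).
  match type of Hq with Rabs ?u < _ =>
    replace u with (- (l + INR (d 0%nat)) - k / (y - x)) in Hq
      by (unfold k; field; exact Hne) end.
  destruct (Nat.eq_dec (eps y 0%nat) (eps x 0%nat)) as [ek|nk].
  - replace k with 0 in Hq by (unfold k; rewrite ek; ring).
    unfold Rdiv in Hq. rewrite Rmult_0_l, Rminus_0_r, Rabs_Ropp in Hq.
    fold E in Hq. lra.
  - assert (Hk : 1 <= Rabs k) by (apply INR_dist_ge_1, nk).
    assert (Hbig : 2 * E <= Rabs (k / (y - x))).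
    { rewrite Rabs_div, Hyx by exact Hne.
      apply -> Rle_div_r; [|exact Hh].
      apply Rle_trans with (2 := Hk).
      apply Rle_trans with (2 * E * / (2 * E)).
      - apply Rmult_le_compat_l; lra.
      - rewrite Rinv_r; lra. }
    assert (Ht := Rabs_triang (- (l + INR (d 0%nat)) - k / (y - x))
                              (l + INR (d 0%nat))).
    replace (- (l + INR (d 0%nat)) - k / (y - x) + (l + INR (d 0%nat)))
      with (- (k / (y - x))) in Ht by ring.
    rewrite Rabs_Ropp in Ht. fold E in Ht. lra.
Qed.
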